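(* Let $(E,\|\cdot\|)$ be a normed linear space over $\mathbb{K}$ ($\mathbb{K}=\mathbb{R}$ or $\mathbb{C}$), let $n\ge 1$ and let $q\ge 1$ be a real number. Then $$\frac{1}{n^{1/q}}\|\mathbf{x}\|_{n,q}\le\|\mathbf{x}\|_{h,n,q}\le\|\mathbf{x}\|_{n,q}$$ for any $\mathbf{x}\in E^n$. In particular, $$\frac{1}{\sqrt n}\|\mathbf{x}\|_{2}\le\|\mathbf{x}\|_{h,e}\le\|\mathbf{x}\|_{2}$$ for any $\mathbf{x}\in E^n$.
   Context: For $\mathbf{x}=(x_1,\dots,x_n)\in E^n$ and real $q\ge1$, $\|\mathbf{x}\|_{n,q}:=(\sum_{k=1}^n\|x_k\|^q)^{1/q}$, and $\|\mathbf{x}\|_2:=\|\mathbf{x}\|_{n,2}$. For $p\in[1,\infty]$ let $\mathbb{B}_{n,p}=\{\lambda=(\lambda_1,\dots,\lambda_n)\in\mathbb{K}^n : \|\lambda\|_{n,p}\le 1\}$, where $\|\lambda\|_{n,p}=(\sum_{k=1}^n|\lambda_k|^p)^{1/p}$ for $p<\infty$ and $\|\lambda\|_{n,\infty}=\max_k|\lambda_k|$. The hypo-$q$-norm on $E^n$ is $$\|\mathbf{x}\|_{h,n,q}:=\sup_{\lambda\in\mathbb{B}_{n,p}}\left\|\sum_{j=1}^n\lambda_jx_j\right\|,$$ where $p$ is the conjugate exponent of $q$ ($\frac1p+\frac1q=1$ if $q>1$; $p=\infty$ if $q=1$). The hypo-Euclidean norm is $\|\mathbf{x}\|_{h,e}:=\|\mathbf{x}\|_{h,n,2}$.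 *)

(* Defs.v *)
From mathcomp Require Export all_boot all_order all_algebra.
From mathcomp Require Export all_classical all_reals all_analysis.
From mathcomp Require Import complex.

Set Implicit Arguments.
Unset Strict Implicit.
Unset Printing Implicit Defensive.

Import Order.TTheory GRing.Theory Num.Theory.
Import numFieldNormedType.Exports.

Local Open Scope classical_set_scope.
Local Open Scope ring_scope.

Variant scalar_kind := RealScalars | ComplexScalars.

Definition scalars (R : realType) (k : scalar_kind) : numFieldType :=
  match k with
  | RealScalars => R
  | ComplexScalars => R[i]
  end.

Definition re_scalar (R : realType) (k : scalar_kind) : scalars R k -> R :=
  match k return scalars R k -> R with
  | RealScalars => fun z => z
  | ComplexScalars => fun z => complex.Re z
  end.

(* In the library a norm over a field K takes its values in K. Such a value is
   a nonnegative element of K, hence a real number even when K is complex: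
   nothing is lost by taking its real part. *)
Definition rnorm (R : realType) (k : scalar_kind)
    (V : normedZmodType (scalars R k)) (v : V) : R :=
  re_scalar `|v|.

(* V is either the normed space or the scalar field itself. Only exponents
   p >= 1 are meant, so that the -oo branch is never used. *)
Definition pnorm (R : realType) (k : scalar_kind)
    (V : normedZmodType (scalars R k)) (n : nat) (p : \bar R)
    (x : 'I_n -> V) : R :=
  match p with
  | r%:E => (\sum_(i < n) rnorm (x i) `^ r) `^ r^-1
  | +oo%E => \big[Num.max/0]_(i < n) rnorm (x i)
  | -oo%E => 0
  end.

Definition lp_ball (R : realType) (k : scalar_kind) (n : nat) (p : \bar R) :
    set ('I_n -> scalars R k) :=
  [set l | pnorm p l <= 1].
Arguments lp_ball : clear implicits.

(* The library's conjugate exponent is extended-real valued, with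
   hoelder_conjugate 1 = +oo (lemma hoelder_conjugate1). The set of reals below
   is nonempty and bounded above by the sum of the norms of the x_j when
   q >= 1, so that [sup] is the actual supremum. *)
Definition hypo_norm (R : realType) (k : scalar_kind)
    (E : normedModType (scalars R k)) (n : nat) (q : R) (x : 'I_n -> E) : R :=
  sup [set rnorm (\sum_(j < n) l j *: x j)
      | l in lp_ball R k n (hoelder_conjugate q%:E)].

Definition norm2 (R : realType) (k : scalar_kind)
    (E : normedModType (scalars R k)) (n : nat) (x : 'I_n -> E) : R :=
  pnorm 2%:E x.

Definition hypo_euclidean_norm (R : realType) (k : scalar_kind)
    (E : normedModType (scalars R k)) (n : nat) (x : 'I_n -> E) : R :=
  hypo_norm 2 x.

(* Main.v *)
(* The upper bound is the triangle inequality followed by Hoelder's inequality.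
   For the lower bound, the unit vectors lie in every lp ball, so each |x_i| is
   at most the hypo-q-norm; summing the n q-th powers gives the factor
   n^(1/q). *)
Require Import Defs.
From mathcomp Require Import complex.

Set Implicit Arguments.
Unset Strict Implicit.
Unset Printing Implicit Defensive.

Import Order.TTheory GRing.Theory Num.Theory.
Import numFieldNormedType.Exports.

Local Open Scope ring_scope.

Lemma sum_powR_eq0 (R : realType) (I : finType) (a : I -> R) (p : R) :
  0 < p -> \sum_i a i `^ p = 0 -> forall i, a i = 0.
Proof.
move=> p0 /eqP; rewrite psumr_eq0; last by move=> i _; exact: powR_ge0.
by move=> /allP h i; apply/powR_eq0_eq0/eqP/(h i)/mem_index_enum.
Qed.

Lemma sum_powR_ge0 (R : realType) (I : finType) (a : I -> R) (p : R) :
  0 <= \sum_i a i `^ p.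
Proof. by apply: sumr_ge0 => i _; exact: powR_ge0. Qed.

Lemma sum_powR_normalized (R : realType) (I : finType) (a : I -> R) (p : R) :
  (forall i, 0 <= a i) -> 0 < p -> \sum_i a i `^ p != 0 ->
  \sum_i (a i / (\sum_j a j `^ p) `^ p^-1) `^ p = 1.
Proof.
move=> a0 p0 S0; have := sum_powR_ge0 a p; set S := \sum_i _ => S_ge0.
have aE i : (a i / S `^ p^-1) `^ p = a i `^ p / S.
  rewrite powRM ?invr_ge0 ?powR_ge0// -powRN -powRrM.
  by rewrite mulNr mulVf ?gt_eqF// powRN powRr1.
by rewrite (eq_bigr _ (fun i _ => aE i)) -mulr_suml mulfV.
Qed.

(** Both families are divided by their norms and Young's inequality is applied term by term. If one
    of the power sums is zero, that family vanishes and so does the left side. *)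
Lemma hoelder_sum (R : realType) (I : finType) (a b : I -> R) (p q : R) :
  (forall i, 0 <= a i) -> (forall i, 0 <= b i) ->
  0 < p -> 0 < q -> p^-1 + q^-1 = 1 ->
  \sum_i a i * b i <=
    (\sum_i a i `^ p) `^ p^-1 * (\sum_i b i `^ q) `^ q^-1.
Proof.
move=> a0 b0 p0 q0 pq.
have [A0|A0] := eqVneq (\sum_i a i `^ p) 0.
  rewrite big1 ?mulr_ge0 ?powR_ge0// => i _.
  by rewrite (@sum_powR_eq0 _ _ a p)// mul0r.
have [B0|B0] := eqVneq (\sum_i b i `^ q) 0.
  rewrite big1 ?mulr_ge0 ?powR_ge0// => i _.
  by rewrite (@sum_powR_eq0 _ _ b q)// mulr0.
have : 0 < (\sum_i a i `^ p) `^ p^-1.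
  by rewrite powR_gt0// lt0r A0 sum_powR_ge0.
have : 0 < (\sum_i b i `^ q) `^ q^-1.
  by rewrite powR_gt0// lt0r B0 sum_powR_ge0.
have := sum_powR_normalized b0 q0 B0.
have := sum_powR_normalized a0 p0 A0.
move: (_ `^ p^-1) (_ `^ q^-1) => A B aA bB B_gt0 A_gt0.
have -> : \sum_i a i * b i = (\sum_i (a i / A) * (b i / B)) * (A * B).
  rewrite mulr_suml; apply: eq_bigr => i _.
  by rewrite mulrACA !divfK ?gt_eqF.
rewrite ler_piMl ?mulr_ge0 ?(ltW A_gt0) ?(ltW B_gt0)//.
(* The bound 1 is written as [p^-1 + q^-1], and each numerator 1 as the power sum of a normalized
   family, so that Young's inequality compares the two sides termwise. *)
rewrite -pq -[p^-1]mul1r -[q^-1]mul1r -[X in _ <= X / p + _]aA.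
rewrite -[X in _ <= _ + X / q]bB.
rewrite !mulr_suml -big_split/=; apply: ler_sum => i _.
exact: (conjugate_powR (divr_ge0 (a0 i) (ltW A_gt0))
  (divr_ge0 (b0 i) (ltW B_gt0)) p0 q0 pq).
Qed.

Section rnorm.
Context (R : realType) (k : scalar_kind).
Implicit Types a b : scalars R k.

Lemma re_scalar0 : re_scalar (0 : scalars R k) = 0.
Proof. by case: k. Qed.

Lemma re_scalar1 : re_scalar (1 : scalars R k) = 1.
Proof. by case: k. Qed.

Lemma re_scalarD a b : re_scalar (a + b) = re_scalar a + re_scalar b.
Proof. by case: k a b => [//|[? ?] [? ?]]. Qed.

Lemma ler_re_scalar a b : a <= b -> re_scalar a <= re_scalar b.
Proof. by case: k a b => [//|a b]; rewrite lecE => /andP[]. Qed.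

(** A nonnegative complex number has zero imaginary part, which kills the cross term of the
    product. *)
Lemma re_scalarM_ge0 a b : 0 <= a -> 0 <= b ->
  re_scalar (a * b) = re_scalar a * re_scalar b.
Proof.
case: k a b => [//|[ar ai] [br bi]].
by rewrite !lecE/= => /andP[/eqP-> _] /andP[/eqP-> _]; rewrite mulr0 subr0.
Qed.

Lemma rnorm_ge0 (V : normedZmodType (scalars R k)) (v : V) : 0 <= rnorm v.
Proof. by rewrite -re_scalar0; exact: ler_re_scalar. Qed.

Lemma rnorm0 (V : normedZmodType (scalars R k)) : rnorm (0 : V) = 0.
Proof. by rewrite /rnorm normr0 re_scalar0. Qed.

Lemma rnorm1 : rnorm (1 : scalars R k) = 1.
Proof. by rewrite /rnorm normr1 re_scalar1. Qed.

Lemma rnormZ (E : normedModType (scalars R k)) a (x : E) :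
  rnorm (a *: x) = rnorm a * rnorm x.
Proof. by rewrite /rnorm normrZ re_scalarM_ge0. Qed.

Lemma ler_rnorm_sum (V : normedZmodType (scalars R k)) (I : finType)
    (x : I -> V) :
  rnorm (\sum_i x i) <= \sum_i rnorm (x i).
Proof.
apply: (big_ind2 (fun v s => rnorm v <= s)); rewrite ?rnorm0//.
move=> v s w t vs wt; apply: (le_trans _ (lerD vs wt)).
by rewrite -re_scalarD; exact/ler_re_scalar/ler_normD.
Qed.

End rnorm.

Section hypo_norm.
Context (R : realType) (k : scalar_kind) (E : normedModType (scalars R k)).
Context (n : nat) (q : R) (q1 : 1 <= q).
Implicit Types x : 'I_n -> E.

Let q0 : 0 < q. Proof. exact: lt_le_trans q1. Qed.

(** Gives the upper bound, and also the boundedness that makes [sup] a genuine supremum. *)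
Lemma rnorm_lincomb_le_pnorm x (l : 'I_n -> scalars R k) :
  lp_ball R k n (hoelder_conjugate q%:E) l ->
  rnorm (\sum_(j < n) l j *: x j) <= pnorm q%:E x.
Proof.
move=> lB; apply: le_trans (ler_rnorm_sum _) _.
under eq_bigr do rewrite rnormZ.
(* For [q = 1] the conjugate exponent is infinite: each coefficient has modulus at most 1, and
   Hoelder's inequality for finite exponents does not apply. *)
move: (q1); rewrite le_eqVlt => /predU1P[qE|q_gt1].
  move: lB; rewrite -qE hoelder_conjugate1 /lp_ball/= => lB.
  rewrite invr1 powRr1 ?sum_powR_ge0//.
  apply: ler_sum => i _; rewrite powRr1 ?rnorm_ge0// ler_piMl ?rnorm_ge0//.
  by apply: le_trans lB; exact: le_bigmax.
have pE : hoelder_conjugate q%:E = (q / (q - 1))%:E.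
  rewrite /hoelder_conjugate/= eqe gt_eqF//.
  by rewrite -EFinD inver subr_eq0 gt_eqF.
move: lB; rewrite pE /lp_ball/= => lB.
apply: le_trans (_ : _ <= _ * pnorm q%:E x) _.
  apply: (@hoelder_sum _ _ _ _ (q / (q - 1))) => //.
  - by move=> i; exact: rnorm_ge0.
  - by move=> i; exact: rnorm_ge0.
  - by rewrite divr_gt0// subr_gt0.
  - by rewrite invf_div -[X in _ + X]div1r -mulrDl subrK divff// gt_eqF.
by rewrite ler_piMl// powR_ge0.
Qed.

Lemma lp_ball_unit (i : 'I_n) :
  lp_ball R k n (hoelder_conjugate q%:E) (fun j => (j == i)%:R).
Proof.
have rn j : rnorm ((j == i)%:R : scalars R k) = (j == i)%:R.
  by case: eqP => _; rewrite ?rnorm1 ?rnorm0.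
have p1 : (1 <= hoelder_conjugate q%:E)%E by exact: hoelder_conj_ge1.
rewrite /lp_ball/=; case: (hoelder_conjugate _) p1 => [p|_|//] /=.
  rewrite lee_fin => p1; rewrite (bigD1 i)//= rn eqxx powR1 big1 ?addr0 ?powR1//.
  (* Since 0 to the power 0 is 1, the off-diagonal terms vanish only because [p] is nonzero. *)
  move=> j /negbTE ji; rewrite rn ji powR0// gt_eqF//; exact: lt_le_trans p1.
by apply: bigmax_le => // j _; rewrite rn; case: eqP.
Qed.

Lemma rnorm_le_hypo_norm x i : rnorm (x i) <= hypo_norm q x.
Proof.
apply: ub_le_sup.
  by exists (pnorm q%:E x) => _ [l lB <-]; exact: rnorm_lincomb_le_pnorm.
exists (fun j => (j == i)%:R); first exact: lp_ball_unit.
rewrite (bigD1 i)//= eqxx scale1r big1 ?addr0// => j /negbTE->.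
by rewrite scale0r.
Qed.

Lemma pnorm_le_hypo_norm x : (0 < n)%N ->
  (n%:R `^ q^-1)^-1 * pnorm q%:E x <= hypo_norm q x.
Proof.
(* Nonnegativity is read off the coordinate of index 0; it is what lets the [q]-th power and the
   [q]-th root cancel below. *)
move=> n0; have h0 : 0 <= hypo_norm q x.
  by apply: le_trans (rnorm_le_hypo_norm x (Ordinal n0)); exact: rnorm_ge0.
rewrite mulrC ler_pdivrMr ?powR_gt0 ?ltr0n//.
(* The right side becomes the [q]-norm of a constant family, leaving a coordinatewise comparison. *)
have -> : hypo_norm q x * n%:R `^ q^-1 =
    (\sum_(i < n) hypo_norm q x `^ q) `^ q^-1.
  rewrite sumr_const card_ord -(mulr_natr (_ `^ q)).
  by rewrite powRM ?powR_ge0// -powRrM mulfV ?gt_eqF// powRr1.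
apply: ge0_ler_powR; rewrite ?nnegrE ?invr_ge0 ?sum_powR_ge0 ?(ltW q0)//.
apply: ler_sum => i _.
by apply: ge0_ler_powR; rewrite ?nnegrE ?rnorm_ge0 ?rnorm_le_hypo_norm ?(ltW q0).
Qed.

Lemma hypo_norm_le_pnorm x : (0 < n)%N -> hypo_norm q x <= pnorm q%:E x.
Proof.
(* The least-upper-bound property requires a nonempty set; a unit vector provides an element. *)
move=> n0; apply: ge_sup => [|_ [l lB <-]]; last exact: rnorm_lincomb_le_pnorm.
apply: image_nonempty; exists (fun j => (j == Ordinal n0)%:R).
exact: lp_ball_unit.
Qed.

End hypo_norm.

Theorem corollary1 (R : realType) (k : scalar_kind)
    (E : normedModType (scalars R k)) (n : nat) (n_ge1 : (1 <= n)%N) :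
  (forall (q : R), 1 <= q -> forall x : 'I_n -> E,
      (n%:R `^ q^-1)^-1 * pnorm q%:E x <= hypo_norm q x /\
      hypo_norm q x <= pnorm q%:E x)
  /\
  (forall x : 'I_n -> E,
      (Num.sqrt (n%:R : R))^-1 * norm2 x <= hypo_euclidean_norm x /\
      hypo_euclidean_norm x <= norm2 x).
Proof.
have bounds (q : R) : 1 <= q -> forall x : 'I_n -> E,
    (n%:R `^ q^-1)^-1 * pnorm q%:E x <= hypo_norm q x /\
    hypo_norm q x <= pnorm q%:E x.
  by move=> q1 x; split; [exact: pnorm_le_hypo_norm|exact: hypo_norm_le_pnorm].
(* With the square root written as the power [2^-1], this is the case [q = 2] up to unfolding. *)
split=> // x; rewrite -powR12_sqrt ?ler0n//.
by apply: bounds; rewrite ler1n.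
Qed.
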